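(* (S-lemma) Let $A,B$ be real symmetric $n\times n$ matrices, $a,b\in\mathbb{R}^n$, $k_1,k_2\in\mathbb{R}$, and $$f(x)=\tfrac12\langle Ax,x\rangle+\langle a,x\rangle+k_1,\qquad g(x)=\tfrac12\langle Bx,x\rangle+\langle b,x\rangle+k_2,\qquad x\in\mathbb{R}^n.$$ Let $P$ be either $\mathbb{R}_+$ or $\{0\}$, suppose $\{x\in\mathbb{R}^n: g(x)\in -P\}\neq\emptyset$ and $0\in\operatorname{ri}(g(\mathbb{R}^n)+P)$. In case $P=\{0\}$, assume additionally that $g\not\equiv 0$ and that at least one of the following conditions holds: (C1) $B=0$ and there exists $u\in\ker A$ such that $(\langle a,u\rangle,\langle b,u\rangle)\neq(0,0)$; (C2) $B\neq 0$; (C3) $B=0$ and $A\succcurlyeq 0$. Then the following are equivalent: (a) for all $x\in\mathbb{R}^n$, $g(x)\in-P$ implies $f(x)\ge 0$; (b) there is $\lambda\in P^*$ such that $f(x)+\lambda g(x)\ge 0$ for all $x\in\mathbb{R}^n$.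
   Context: $\mathbb{R}_+=[0,+\infty[$. $\operatorname{ri}$ denotes the relative interior (interior relative to the affine hull). $P^*=\{\xi\in\mathbb{R}:\xi p\ge0\ \forall p\in P\}$, so $P^*=\mathbb{R}_+$ if $P=\mathbb{R}_+$ and $P^*=\mathbb{R}$ if $P=\{0\}$. $A\succcurlyeq0$ means $\langle Ax,x\rangle\ge0$ for all $x$. *)

(* Defs.v *)
From HB Require Import structures.
From mathcomp Require Import all_boot all_order all_algebra.
From mathcomp Require Import all_classical all_reals all_analysis.

Set Implicit Arguments.
Unset Strict Implicit.
Unset Printing Implicit Defensive.

Import Order.TTheory GRing.Theory Num.Theory.
Import numFieldNormedType.Exports.

Local Open Scope classical_set_scope.
Local Open Scope ring_scope.

Definition inner (R : realType) (n : nat) (x y : 'cV[R]_n) : R :=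
  \sum_(i < n) x i 0 * y i 0.

Definition quadf (R : realType) (n : nat) (A : 'M[R]_n) (a : 'cV[R]_n) (k : R)
    (x : 'cV[R]_n) : R :=
  2^-1 * inner (A *m x) x + inner a x + k.

Definition psdmx (R : realType) (n : nat) (A : 'M[R]_n) : Prop :=
  forall x : 'cV[R]_n, 0 <= inner (A *m x) x.

Definition setN (V : zmodType) (C : set V) : set V := [set - x | x in C].

Definition minkowski_sum (V : zmodType) (C D : set V) : set V :=
  [set x + y | x in C & y in D].

Definition dual_cone (R : realType) (P : set R) : set R :=
  [set xi | forall p, P p -> 0 <= xi * p].

Definition affine_set (R : realType) (V : lmodType R) (M : set V) : Prop :=
  forall (t : R) (x y : V), M x -> M y -> M ((1 - t) *: x + t *: y).

Definition affine_hull (R : realType) (V : lmodType R) (C : set V) : set V :=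
  smallest (@affine_set R V) C.

(* [within (affine_hull C) (nbhs x)] is the neighbourhood filter of [x] for the
   topology induced on the affine hull. *)
Definition relint (R : realType) (V : normedModType R) (C : set V) : set V :=
  [set x | affine_hull C x /\ within (affine_hull C) (nbhs x) C].

(* Main.v *)
Require Import Defs.
From HB Require Import structures.
From mathcomp Require Import all_boot all_order all_algebra.
From mathcomp Require Import all_classical all_reals all_analysis.
From mathcomp Require Import ring lra.

(* For [g x < 0 < g y], the binary form obtained by homogenizing [g] on the line
   through [x] and [y] vanishes at two points of opposite sign. A suitable
   positive combination of the values of the form of [f] at these two points
   eliminates its mixed coefficient and gives
   [f x * g y - f y * g x >= 0], which says that every lower bound [- f y / g y]
   on the multiplier lies below every upper bound [f x / - g x]; their supremum
   is a multiplier. The only difficulty is a root at infinity on the line, that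
   is [<B (y - x), y - x> = 0]; it is removed by perturbing [x] when [B <> 0],
   and by the sign of [<A (y - x), y - x>] for inequalities and under (C3).
   Under (C1), translating along [u] onto [g = 0] gives the multiplier
   [- <a, u> / <b, u>]. *)

Set Implicit Arguments.
Unset Strict Implicit.
Unset Printing Implicit Defensive.

Import Order.TTheory GRing.Theory Num.Theory.
Import numFieldNormedType.Exports.

Local Open Scope classical_set_scope.
Local Open Scope ring_scope.

(** * Inner products and quadratic functions along lines *)

Section InnerProduct.
Variables (R : realType) (n : nat).
Implicit Types (x y z u v : 'cV[R]_n) (A : 'M[R]_n).

Lemma innerC x y : inner x y = inner y x.
Proof. by apply: eq_bigr => i _; rewrite mulrC. Qed.

Lemma innerDl x y z : inner (x + y) z = inner x z + inner y z.
Proof. by rewrite -big_split; apply: eq_bigr => i _; rewrite mxE mulrDl. Qed.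

Lemma innerZl t x y : inner (t *: x) y = t * inner x y.
Proof. by rewrite mulr_sumr; apply: eq_bigr => i _; rewrite mxE mulrA. Qed.

Lemma innerDr x y z : inner z (x + y) = inner z x + inner z y.
Proof. by rewrite !(innerC z) innerDl. Qed.

Lemma innerZr t x y : inner y (t *: x) = t * inner y x.
Proof. by rewrite !(innerC y) innerZl. Qed.

Lemma inner0l y : inner 0 y = 0.
Proof. by rewrite -(scale0r (0 : 'cV[R]_n)) innerZl mul0r. Qed.

Lemma innerE x y : inner x y = (x^T *m y) 0 0.
Proof. by rewrite mxE; apply: eq_bigr => i _; rewrite mxE. Qed.

Lemma inner_mulmxC A x y : A^T = A -> inner (A *m x) y = inner (A *m y) x.
Proof.
by move=> symA; rewrite innerC !innerE
  trmx_mul symA mulmxA.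
Qed.

Lemma quadf_line A a k x d t : A^T = A ->
  quadf A a k (x + t *: d) =
  quadf A a k x + t * (inner (A *m x) d + inner a d)
    + t ^+ 2 * (2^-1 * inner (A *m d) d).
Proof.
move=> symA; rewrite /quadf mulmxDr -scalemxAr.
rewrite !(innerDl, innerDr, innerZl, innerZr) (inner_mulmxC d x symA).
by field.
Qed.

(** Polarization: evaluating the form at a sum of two basis vectors isolates twice an entry of
    [A]. *)
Lemma sym_quadratic_form_eq0 A : A^T = A ->
  (forall x, inner (A *m x) x = 0) -> A = 0.
Proof.
move=> symA A0; apply/matrixP => i j.
have /eqP := A0 (delta_mx j 0 + delta_mx i 0).
rewrite mulmxDr !(innerDl, innerDr) !A0 add0r addr0.
rewrite (inner_mulmxC (delta_mx i 0) _ symA) -mulr2n mulrn_eq0 /= => /eqP.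
rewrite /inner (bigD1 i) //= big1 => [|l lNi]; last first.
  by rewrite [X in _ * X]mxE (negPf lNi) mulr0.
by rewrite addr0 -colE !mxE !eqxx mulr1.
Qed.

End InnerProduct.

(** * Quadratic polynomials in one real variable *)

Section RealQuadratics.
Variable R : realType.

(** Since [c * d < 0], the discriminant exceeds [h ^+ 2], so its square root dominates [|h|] and
    fixes the signs of both roots. *)
Lemma quadratic_opposite_roots (c h d : R) : c < 0 -> 0 < d ->
  exists r s, [/\ 0 < r, s < 0, c + h * r + d * r ^+ 2 = 0
    & c + h * s + d * s ^+ 2 = 0].
Proof.
move=> c_lt0 d_gt0.
pose D := h ^+ 2 - 4 * c * d.
have D_gt : h ^+ 2 < D by rewrite /D; nra.
have D_ge0 : 0 <= D by apply: le_trans (ltW D_gt); exact: sqr_ge0.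
have qE : Num.sqrt D ^+ 2 = D by rewrite sqr_sqrtr.
have q_gt : `|h| < Num.sqrt D.
  by rewrite -sqrtr_sqr ltr_sqrt //; apply: le_lt_trans D_gt; exact: sqr_ge0.
move: q_gt; rewrite ltr_norml => /andP[q1 q2].
have rootP e : e ^+ 2 = 1 ->
    let r := (- h + e * Num.sqrt D) / (2 * d) in c + h * r + d * r ^+ 2 = 0.
  move=> e1 r; have -> : c + h * r + d * r ^+ 2 =
      (e ^+ 2 * Num.sqrt D ^+ 2 - (h ^+ 2 - 4 * c * d)) / (4 * d).
    by rewrite /r; field; rewrite gt_eqF.
  by rewrite e1 qE mul1r subrr mul0r.
exists ((- h + 1 * Num.sqrt D) / (2 * d)), ((- h + -1 * Num.sqrt D) / (2 * d)).
split.
- by rewrite divr_gt0 //; lra.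
- by rewrite pmulr_llt0 ?invr_gt0; lra.
- by apply: rootP; rewrite expr1n.
- by apply: rootP; rewrite sqrrN expr1n.
Qed.

(* Along [t = r / (1 + r)] both quadratics become binary forms in [(1, r)].
   The one of [g] has a positive and a negative root, and the combination of
   the values of the other form there that cancels its mixed coefficient is
   the claimed inequality. The root [r = -1] is the point at infinity of the
   line, hence the hypothesis on leading coefficients. *)
Lemma quadratic_cross_ge0 (f0 f1 f2 g0 g1 g2 : R) :
  g0 < 0 -> 0 < g0 + g1 + g2 -> (g2 = 0 -> 0 <= f2) ->
  (forall t, g0 + t * g1 + t ^+ 2 * g2 = 0 ->
     0 <= f0 + t * f1 + t ^+ 2 * f2) ->
  0 <= f0 * (g0 + g1 + g2) - (f0 + f1 + f2) * g0.
Proof.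
move=> g0_lt0 gy_gt0 inf_ge0 zero_ge0.
have [r [s [r_gt0 s_lt0 r_root s_root]]] :=
  quadratic_opposite_roots (2 * g0 + g1) g0_lt0 gy_gt0.
have form_ge0 w : g0 + (2 * g0 + g1) * w + (g0 + g1 + g2) * w ^+ 2 = 0 ->
    0 <= f0 + (2 * f0 + f1) * w + (f0 + f1 + f2) * w ^+ 2.
  have [-> root|wN1 root] := eqVneq w (-1).
    have := inf_ge0; have -> : g2 = 0 by lra.
    by move=> /(_ erefl); lra.
  have w1 : 1 + w != 0 by apply: contra_neq wN1 => ?; lra.
  have homog (c0 c1 c2 : R) : c0 + (2 * c0 + c1) * w + (c0 + c1 + c2) * w ^+ 2 =
      (1 + w) ^+ 2 * (c0 + w / (1 + w) * c1 + (w / (1 + w)) ^+ 2 * c2).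
    by field.
  rewrite homog mulr_ge0 ?sqr_ge0 // zero_ge0 //.
  by move/eqP: root; rewrite homog mulf_eq0 expf_eq0 /= (negPf w1) => /eqP.
have Fr := form_ge0 r r_root; have Fs := form_ge0 s s_root.
have rs_gt0 : 0 < r - s by lra.
set gy := g0 + g1 + g2 in gy_gt0 r_root s_root *.
set fy := f0 + f1 + f2 in Fr Fs *.
(* Vieta: subtract the two root equations and cancel [r - s]. *)
have hE : 2 * g0 + g1 = - gy * (r + s).
  apply: (mulfI (lt0r_neq0 rs_gt0)); nra.
have g0E : g0 = gy * (r * s) by move: r_root; rewrite hE; nra.
(* This is [- s] times [Fr] plus [r] times [Fs]; both weights are positive and the mixed terms
   cancel. *)
have combine : 0 <= (r - s) * (f0 - r * s * fy) by nra.
move: combine; rewrite pmulr_rge0 // => combine.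
rewrite [X in _ - fy * X]g0E.
have -> : f0 * gy - fy * (gy * (r * s)) = gy * (f0 - r * s * fy) by ring.
by rewrite mulr_ge0 // ltW.
Qed.

Lemma quadratic_lt0_near0 (c0 c1 c2 : R) : c0 < 0 ->
  exists2 e, 0 < e & forall t, 0 < t < e -> c0 + t * c1 + t ^+ 2 * c2 < 0.
Proof.
move=> c0_lt0; pose S := `|c1| + `|c2| + 1.
have S_gt0 : 0 < S by rewrite ltr_wpDl ?addr_ge0.
(* For [t < 1] the non-constant terms are at most [t * S]; the summand 1 in [S] only keeps it
   positive. *)
exists (Num.min 1 (- c0 / S)); first by rewrite lt_min ltr01 divr_gt0 // oppr_gt0.
move=> t; rewrite lt_min ltr_pdivlMr // => /and3P[t_gt0 t_lt1 tS].
have c1_le : t * c1 <= t * `|c1| by rewrite ler_pM2l // ler_norm.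
have c2_le : t ^+ 2 * c2 <= t * `|c2|.
  apply: (@le_trans _ _ (t ^+ 2 * `|c2|)).
    by rewrite ler_pM2l ?exprn_gt0 // ler_norm.
  by rewrite ler_wpM2r // expr2 ger_pMr // ltW.
by rewrite /S in tS; lra.
Qed.

(** Substituting [t^-1] for [t] exchanges [c0] and [c2], so a negative [c2] would make the
    polynomial negative for large arguments. *)
Lemma quadratic_ge0_lead (c0 c1 c2 : R) :
  (forall t, 0 <= t -> 0 <= c0 + t * c1 + t ^+ 2 * c2) -> 0 <= c2.
Proof.
move=> quad_ge0; rewrite leNgt; apply/negP => c2_lt0.
have [e e_gt0 small] := quadratic_lt0_near0 c1 c0 c2_lt0.
pose t := e / 2; have t_gt0 : 0 < t by rewrite divr_gt0.
have t_lt : 0 < t < e by rewrite t_gt0 /t /=; lra.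
have := quad_ge0 t^-1; rewrite invr_ge0 (ltW t_gt0) => /(_ isT).
have -> : c0 + t^-1 * c1 + t^-1 ^+ 2 * c2 =
    t^-1 ^+ 2 * (c2 + t * c1 + t ^+ 2 * c0) by field; rewrite gt_eqF.
by rewrite pmulr_rge0 ?exprn_gt0 ?invr_gt0 // leNgt small.
Qed.

End RealQuadratics.

(** * Existence of a multiplier, and relative interiors on the real line *)

Lemma multiplier_exists (R : realType) (T : Type) (f g : T -> R) :
  (exists x, g x < 0) -> (exists y, 0 < g y) ->
  (forall x, g x = 0 -> 0 <= f x) ->
  (forall x y, g x < 0 -> 0 < g y -> 0 <= f x * g y - f y * g x) ->
  exists l, forall x, 0 <= f x + l * g x.
Proof.
move=> [x0 gx0] [y0 gy0] zero_ge0 cross_ge0.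
pose E : set R := [set - f y / g y | y in [set y | 0 < g y]].
have E_ub x : g x < 0 -> ubound E (f x / - g x).
  move=> gx _ [y /= gy <-]; rewrite ler_pdivrMr // mulrAC ler_pdivlMr ?oppr_gt0 //.
  by have := cross_ge0 x y gx gy; lra.
have E_sup : has_sup E.
  by split; [exists (- f y0 / g y0), y0 | exists (f x0 / - g x0); exact: E_ub].
exists (sup E) => x; have [gx|gx|gx] := ltrgt0P (g x).
- have : - f x / g x <= sup E by apply: (sup_upper_bound E_sup); exists x.
  by rewrite ler_pdivrMr //; lra.
- have : sup E <= f x / - g x by apply: ge_sup; [exact: E_sup.1 | exact: E_ub].
  by rewrite ler_pdivlMr ?oppr_gt0 //; lra.
- by rewrite gx mulr0 addr0 zero_ge0.
Qed.

(** Two distinct points have the whole line as affine hull, so the relative interior is the ordinary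
    one. *)
Lemma relint0_two_sided (R : realType) (C : set R^o) (c c' : R) :
  C c -> C c' -> c != c' -> relint C 0 ->
  exists2 e : R, 0 < e & C e /\ C (- e).
Proof.
move=> Cc Cc' cc' [_].
have -> : affine_hull C = setT.
  apply/seteqP; split=> // z _ M [affM CM].
  have c'c : c' - c != 0 by rewrite subr_eq0 eq_sym.
  have -> : z = (1 - (z - c) / (c' - c)) *: (c : R^o) +
      ((z - c) / (c' - c)) *: (c' : R^o).
    by rewrite /GRing.scale /=; field.
  by apply: affM; apply: CM.
rewrite /within /= => /nbhs_ballP[e /= e_gt0 ballC].
exists (e / 2); first by rewrite divr_gt0.
have small : `|e / 2| < e by rewrite gtr0_norm ?divr_gt0 //; lra.
by split; apply: ballC => //; rewrite -ball_normE /= sub0r ?normrN // opprK.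
Qed.

(** * Multipliers for a pair of quadratic functions *)

Section QuadraticPair.
Variables (R : realType) (n : nat) (A B : 'M[R]_n) (a b : 'cV[R]_n) (k1 k2 : R).
Hypotheses (symA : A^T = A) (symB : B^T = B).
Let f := quadf A a k1.
Let g := quadf B b k2.

Lemma quadf_cross_ge0 x y :
  (forall z, g z = 0 -> 0 <= f z) -> g x < 0 -> 0 < g y ->
  (inner (B *m (y - x)) (y - x) = 0 -> 0 <= inner (A *m (y - x)) (y - x)) ->
  0 <= f x * g y - f y * g x.
Proof.
move=> zero_ge0 gx gy inf_ge0; set d := y - x in inf_ge0.
have yE : y = x + 1 *: d by rewrite scale1r addrC subrK.
move: gy; rewrite /f /g yE !quadf_line // !mul1r expr1n !mul1r => gy.
apply: quadratic_cross_ge0 => // [|t].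
  by move=> d0; rewrite mulr_ge0 ?invr_ge0 ?inf_ge0 //; lra.
by rewrite -!quadf_line //; apply: zero_ge0.
Qed.

(* Every pair [x, y] is a limit of pairs whose difference is not isotropic
   for [B], and the inequality is a closed condition. *)
Lemma quadf_cross_ge0_neq0 x y : B != 0 ->
  (forall z, g z = 0 -> 0 <= f z) -> g x < 0 -> 0 < g y ->
  0 <= f x * g y - f y * g x.
Proof.
move=> B0 zero_ge0 gx gy; rewrite leNgt; apply/negP => cross_lt0.
have [w wB] : exists w, inner (B *m w) w != 0.
  apply: contrapT => noB; move/eqP: B0; apply; apply: sym_quadratic_form_eq0 => // w.
  by apply/eqP/negPn/negP => ?; apply: noB; exists w.
have [e1 e1_gt0 g_small] := quadratic_lt0_near0
  (inner (B *m x) w + inner b w) (2^-1 * inner (B *m w) w) gx.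
have [e2 e2_gt0 cross_small] := quadratic_lt0_near0
  ((inner (A *m x) w + inner a w) * g y - f y * (inner (B *m x) w + inner b w))
  ((2^-1 * inner (A *m w) w) * g y - f y * (2^-1 * inner (B *m w) w)) cross_lt0.
(* For small [t] the perturbed pair still violates the inequality, which is possible only if its
   difference is isotropic. *)
have isotropic t : 0 < t < e1 -> t < e2 ->
    inner (B *m (y - (x + t *: w))) (y - (x + t *: w)) = 0.
  move=> te1 te2; have /andP[t_gt0 _] := te1.
  apply/eqP/negPn/negP => /eqP nonisotropic.
  have := cross_small t; rewrite t_gt0 te2 => /(_ isT); apply/negP; rewrite -leNgt.
  have := @quadf_cross_ge0 (x + t *: w) y zero_ge0.
  rewrite /f /g !(quadf_line _ _ x) // => /(_ (g_small t te1) gy) cross.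
  have {}cross := cross (fun iso => False_ind _ (nonisotropic iso)).
  by apply: le_trans cross _; rewrite le_eqVlt; apply/predU1P; left; ring.
pose e := Num.min e1 e2.
have e_gt0 : 0 < e by rewrite lt_min e1_gt0.
have [ee1 ee2] : e <= e1 /\ e <= e2 by rewrite !ge_min !lexx orbT.
set d := y - x.
have isoE t : 0 < t < e ->
    inner (B *m d) d - 2 * t * inner (B *m d) w + t ^+ 2 * inner (B *m w) w = 0.
  move=> /andP[t0 te]; rewrite -(isotropic t) ?t0 /=; [|lra|lra].
  have -> : y - (x + t *: w) = d + (- t) *: w by rewrite scaleNr opprD addrA.
  move: d => d; rewrite mulmxDr -scalemxAr !(innerDl, innerDr, innerZl, innerZr).
  by rewrite (inner_mulmxC w d symB); ring.
(* A polynomial of degree at most two with three distinct zeros has zero leading coefficient,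
   contradicting [wB]. *)
have := isoE (e / 2); have := isoE (e / 3); have := isoE (e / 4).
have -> : 0 < e / 2 < e by apply/andP; lra.
have -> : 0 < e / 3 < e by apply/andP; lra.
have -> : 0 < e / 4 < e by apply/andP; lra.
move=> /(_ isT) i4 /(_ isT) i3 /(_ isT) i2.
have /eqP : e ^+ 2 * inner (B *m w) w = 0 by lra.
by rewrite mulf_eq0 (negPf wB) expf_eq0 /= gt_eqF.
Qed.

Lemma equality_multiplier :
  (exists x, g x < 0) -> (exists y, 0 < g y) ->
  [\/ B = 0 /\ (exists u, A *m u = 0 /\ (inner a u, inner b u) <> (0, 0)),
      B <> 0 | B = 0 /\ psdmx A] ->
  (forall x, g x = 0 -> 0 <= f x) ->
  exists l, forall x, 0 <= f x + l * g x.
Proof.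
move=> g_neg g_pos cases zero_ge0; case: cases.
- move=> [B0 [u [Au0 ab_neq0]]].
  have fu x t : f (x + t *: u) = f x + t * inner a u.
    by rewrite /f quadf_line // (inner_mulmxC x u symA) Au0 !inner0l; ring.
  have gu x t : g (x + t *: u) = g x + t * inner b u.
    by rewrite /g quadf_line // B0 !mul0mx !inner0l; ring.
  have [bu0|bu0] := eqVneq (inner b u) 0; last first.
    exists (- inner a u / inner b u) => x.
    have := zero_ge0 (x + (- g x / inner b u) *: u).
    rewrite gu fu divfK // subrr => /(_ erefl).
    by congr (0 <= _ + _); ring.
  (* Moving along [u] now preserves [g] while [f] is affine with nonzero slope, so [f] takes the
     value -1 on [g = 0]: a contradiction. *)
  have au0 : inner a u != 0.
    by apply/eqP => au0; apply: ab_neq0; rewrite au0 bu0.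
  have [[x0 gx0] [y0 gy0]] := (g_neg, g_pos).
  have [z gz] : exists z, g z = 0.
    have gline t : g (x0 + t *: (y0 - x0)) =
        g x0 + t * (inner b (y0 - x0)).
      by rewrite /g quadf_line // B0 !mul0mx !inner0l; ring.
    have := gline 1; rewrite scale1r addrC subrK mul1r => gy0E.
    have bd : inner b (y0 - x0) != 0.
      by apply/eqP => bd0; move: gy0; rewrite gy0E bd0 addr0 ltNge ltW.
    exists (x0 + (- g x0 / inner b (y0 - x0)) *: (y0 - x0)).
    by rewrite gline divfK // subrr.
  have := zero_ge0 (z + (- (f z + 1) / inner a u) *: u).
  rewrite gu fu divfK // bu0 mulr0 addr0 => /(_ gz).
  by rewrite opprD addNKr ler0N1.
- move=> /eqP B0; apply: multiplier_exists => // x y gx gy.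
  exact: quadf_cross_ge0_neq0.
- move=> [_ psdA]; apply: multiplier_exists => // x y gx gy.
  by apply: quadf_cross_ge0 => // _; apply: psdA.
Qed.

Lemma inequality_multiplier :
  (exists x, g x < 0) -> (forall x, g x <= 0 -> 0 <= f x) ->
  exists2 l, 0 <= l & forall x, 0 <= f x + l * g x.
Proof.
move=> g_neg neg_ge0.
have [g_pos|g_npos] := pselect (exists y, 0 < g y); last first.
  exists 0 => // x; rewrite mul0r addr0 neg_ge0 // leNgt.
  by apply/negP => gx; apply: g_npos; exists x.
have [l fl_ge0] : exists l, forall x, 0 <= f x + l * g x.
  apply: multiplier_exists => // [x gx|x y gx gy].
    by apply: neg_ge0; rewrite gx.
  apply: quadf_cross_ge0 => // [z gz|]; first by apply: neg_ge0; rewrite gz.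
  set d := y - x => dB.
  have gline t : g (x + t *: d) = g x + t * (g y - g x).
    have yE : y = x + 1 *: d by rewrite scale1r addrC subrK.
    rewrite [in g y]yE /g !quadf_line // dB; ring.
  (* [g] is affine on this line and negative at [x], so the backward ray from
     [x] stays in the feasible set. *)
  suff : 0 <= 2^-1 * inner (A *m d) d by rewrite pmulr_rge0 // invr_gt0.
  apply: (@quadratic_ge0_lead _ (f x) (- (inner (A *m x) d + inner a d))).
  move=> t t_ge0; rewrite mulrN -mulNr -sqrrN -quadf_line //.
  by apply: neg_ge0; rewrite gline; nra.
have [l_ge0|l_lt0] := lerP 0 l; first by exists l.
(* With [l < 0], [f] is already nonnegative where [g > 0]. *)
exists 0 => // x; rewrite mul0r addr0.
have [gx|gx] := lerP (g x) 0; first exact: neg_ge0.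
by have := fl_ge0 x; nra.
Qed.

End QuadraticPair.

(** * The equivalence, for each of the two cones *)

Theorem theorem5p3 (R : realType) (n : nat) (A B : 'M[R]_n) (a b : 'cV[R]_n)
    (k1 k2 : R) (P : set R) (f g : 'cV[R]_n -> R)
    (symA : A^T = A) (symB : B^T = B)
    (fE : f = quadf A a k1) (gE : g = quadf B b k2)
    (hP : P = [set t : R | 0 <= t] \/ P = [set 0])
    (feas : [set x | setN P (g x)] !=set0)
    (slater : relint (minkowski_sum (range g) P : set R^o) 0)
    (hP0 : P = [set 0] ->
      ~ (forall x, g x = 0) /\
      [\/ B = 0 /\ (exists u : 'cV[R]_n,
            A *m u = 0 /\ (inner a u, inner b u) <> (0, 0)),
          B <> 0
        | B = 0 /\ psdmx A]) :
  (forall x, setN P (g x) -> 0 <= f x) <->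
  (exists lambda : R, dual_cone P lambda /\
     forall x, 0 <= f x + lambda * g x).
Proof.
have setNE : (forall x, setN P (g x) <-> P (- g x)).
  move=> x; split=> [[p Pp <-]|Pg]; first by rewrite opprK.
  by exists (- g x); rewrite ?opprK.
split=> [feas_ge0|[l [Pl fl_ge0]] x /setNE Pgx]; last first.
  have := fl_ge0 x; have := Pl _ Pgx; case: hP Pgx => -> /=; lra.
have [x0 /= /setNE Px0] := feas.
case: hP => PE.
- have Csum c p : 0 <= p -> range g c -> minkowski_sum (range g) P (c + p).
    by move=> p_ge0 gc; exists c => //; exists p; rewrite ?PE.
  have gx0 : range g (g x0) by exists x0.
  (* The point [- e] of the sum gives [g x1 = - e - p < 0], a Slater point. *)
  have [|e e_gt0 [_ [_ [x1 _ <-] [p Pp gpE]]]] :=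
    relint0_two_sided (Csum _ 0 (lexx 0) gx0) (Csum _ 1 ler01 gx0) _ slater.
    by apply/eqP => /addrI/esym/eqP; rewrite oner_eq0.
  rewrite PE /= in Pp.
  have [||l l_ge0 fl_ge0] := @inequality_multiplier R n A B a b k1 k2 symA symB.
  + by exists x1; rewrite -gE; lra.
  + rewrite -fE -gE => x gx; apply: feas_ge0; apply/setNE.
    by rewrite PE /= oppr_ge0.
  + exists l; rewrite PE; split; first by move=> p'; exact: mulr_ge0.
    by rewrite fE gE.
- have [g_neq0 cases] := hP0 PE.
  rewrite PE /= in Px0.
  have Cg x : minkowski_sum (range g) P (g x).
    by exists (g x); [exists x | exists 0; rewrite ?PE ?addr0].
  have [x1 gx1] : exists x, g x != 0.
    by move/existsNP: g_neq0 => [x /eqP ?]; exists x.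
  (* Feasibility gives [g x0 = 0]; two distinct values let the relative interior supply values of
     [g] of both signs. *)
  have gx01 : g x0 != g x1 by rewrite -[g x0]opprK Px0 oppr0 eq_sym.
  have [e e_gt0 [[_ [y _ <-] [p Pp gyE]] [_ [z _ <-] [q Pq gzE]]]] :=
    relint0_two_sided (Cg x0) (Cg x1) gx01 slater.
  rewrite PE /= in Pp Pq; rewrite Pp addr0 in gyE; rewrite Pq addr0 in gzE.
  have [||| l fl_ge0] := @equality_multiplier R n A B a b k1 k2 symA symB _ _ cases.
  + by exists z; rewrite -gE gzE oppr_lt0.
  + by exists y; rewrite -gE gyE.
  + by rewrite -fE -gE => x gx; apply: feas_ge0; apply/setNE; rewrite PE gx /= oppr0.
  + exists l; rewrite PE fE gE; split=> // _ ->.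
    by rewrite mulr0.
Qed.
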